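(* Let $\Bbbk$ be an algebraically closed field, let $d\geq 3$ be an integer, and let $P_1,\ldots,P_{d+4}\in\mathbb{P}^d=\mathbb{P}^d_{\Bbbk}$ be points in general linear position. Then $P_1,\ldots,P_{d+4}$ lie on a rational normal curve in $\mathbb{P}^d$ if and only if for every $6$-element subset $I=\{i_1<\ldots<i_6\}\subseteq\{1,\dots,d+4\}$, with complement $I^c=\{1,\ldots,d+4\}\setminus I=\{j_1<\ldots<j_{d-2}\}$, the following $d+1$ points lie on a common hyperplane of $\mathbb{P}^d$: \begin{itemize} \item the intersection of the line $P_{i_1}P_{i_2}$ with the hyperplane $P_{i_4}P_{i_5}P_{j_1}\ldots P_{j_{d-2}}$; \item the intersection of the line $P_{i_2}P_{i_3}$ with the hyperplane $P_{i_5}P_{i_6}P_{j_1}\ldots P_{j_{d-2}}$; \item the intersection of the line $P_{i_3}P_{i_4}$ with the hyperplane $P_{i_1}P_{i_6}P_{j_1}\ldots P_{j_{d-2}}$; \item the points $P_{j_1},\ldots,P_{j_{d-2}}$. \end{itemize}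
   Context: The base field $\Bbbk$ is algebraically closed of arbitrary characteristic. A rational normal curve in $\mathbb{P}^d$ is a smooth rational curve of degree $d$ in $\mathbb{P}^d$, unique up to projective isomorphism (the image of $\mathbb{P}^1$ under $[s:t]\mapsto[s^d:s^{d-1}t:\ldots:t^d]$, up to a projective change of coordinates). Points of $\mathbb{P}^d$ are in general linear position if any $d+1$ of them span $\mathbb{P}^d$. A juxtaposition such as $P_aP_b$ or $P_aP_bP_{j_1}\ldots P_{j_{d-2}}$ denotes the linear span of the listed points. *)

(* Defs.v *)
From mathcomp Require Import all_boot all_order all_algebra.

Set Implicit Arguments.
Unset Strict Implicit.
Unset Printing Implicit Defensive.

Import GRing.Theory.
Local Open Scope ring_scope.

(** Linear subspaces of P^d are handled as subspaces of k^(d+1): linear spans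
    are sums, and a linear subspace of projective dimension r has [\dim] r+1. *)

Record proj_point (k : fieldType) (d : nat) := ProjPoint {
  pt_line :> {vspace 'rV[k]_d.+1};
  _ : \dim pt_line == 1%N }.

Definition hyperplane (k : fieldType) (d : nat)
    (H : {vspace 'rV[k]_d.+1}) : Prop :=
  \dim H = d.

Definition span_pts (k : fieldType) (d : nat) (T : finType)
    (P : T -> proj_point k d) (J : {set T}) : {vspace 'rV[k]_d.+1} :=
  (\sum_(j in J) P j)%VS.

Definition general_linear_position (k : fieldType) (d : nat) (T : finType)
    (P : T -> proj_point k d) : Prop :=
  forall J : {set T}, #|J| = d.+1 -> span_pts P J = fullv.

Definition veronese (k : fieldType) (d : nat) (s t : k) : 'rV[k]_d.+1 :=
  \row_(i < d.+1) (s ^+ (d - i) * t ^+ i).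

(** A curve is given by its set of k-points, which determines it when k is
    algebraically closed; [g] is the projective change of coordinates. *)
Definition rational_normal_curve (k : fieldType) (d : nat)
    (C : proj_point k d -> Prop) : Prop :=
  exists2 g : 'M[k]_d.+1, g \in unitmx &
    forall p : proj_point k d,
      C p <-> exists s t : k,
        (s, t) != (0, 0) /\ pt_line p = <[veronese d s t *m g]>%VS.

(* Main.v *)
Require Import Defs.
From HB Require Import structures.
From mathcomp Require Import all_boot all_order all_algebra.
From mathcomp Require Import ring zify.

(** Fix three of the points, u, v, w, and use the other d + 1 points p_j as a
    basis.  By general position every coordinate of u, v and w is nonzero, and
    the standard Cremona transformation, which inverts all coordinates, carries
    the rational normal curves through the p_j to lines.  So the d + 4 points
    lie on a rational normal curve exactly when the reciprocal vectors
    (1 / u_j), (1 / v_j), (1 / w_j) are collinear, that is, when all 3 x 3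
    minors of the matrix they form vanish.

    Each of these minors is a Pascal condition
    ([pascal_iff_reciprocals_collinear]).  Modulo the span of the points outside
    the 6-element set I the configuration becomes a hexagon p_1 p_2 p_3 u v w
    in a plane; the three intersection points have explicit coordinates there,
    and their determinant is, up to a nonzero factor, the 3 x 3 minor of the
    reciprocals in the columns 1, 2, 3.

    If the points lie on a rational normal curve with parameters x_i, then the
    coordinate of the point with parameter x along p_j is proportional to the
    product of the brackets [x, x_m] over the basis points m other than j
    (Lagrange interpolation).  Its reciprocal is therefore [x, x_j] up to a
    factor that depends only on x and a factor that depends only on j
    ([dual_form_on_curve]).  The bracket is bilinear on a 2-dimensional space,
    so every 3 x 3 minor vanishes, for every I.

    Conversely, let u, v, w be the last three points, and j0, j1 the first two.
    The Pascal conditions for the sets {j0, j1, j, u, v, w} say that column j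
    satisfies the linear relation between the three rows that holds in columns
    j0 and j1, hence 1 / w_j = l / u_j + m / v_j for all j
    ([curve_of_pascal_conditions]).  The curve sending (s, t) to
    the sum over j of (product over m <> j of (s / u_m + t / v_m)) p_j
    then passes through u, v and w at (1, 0), (0, 1) and (l, m), and through
    p_j at the root of its j-th factor ([curve_through_points]). *)

Set Implicit Arguments.
Unset Strict Implicit.
Unset Printing Implicit Defensive.
Import GRing.Theory.
Local Open Scope ring_scope.

(** * Determinants of order three *)

Definition det3 (R : pzRingType) (a1 a2 a3 b1 b2 b3 c1 c2 c3 : R) : R :=
  a1 * (b2 * c3 - b3 * c2) - a2 * (b1 * c3 - b3 * c1)
  + a3 * (b1 * c2 - b2 * c1).

(** The columns of the determinant are paired with the unknowns x, y, z, so a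
    solution is a line through the three points given by the rows. *)
Lemma det3_eq0 (k : fieldType) (a1 a2 a3 b1 b2 b3 c1 c2 c3 : k) :
  (exists x y z, [/\ (x != 0) || (y != 0) || (z != 0),
      x * a1 + y * a2 + z * a3 = 0, x * b1 + y * b2 + z * b3 = 0
    & x * c1 + y * c2 + z * c3 = 0])
  <-> det3 a1 a2 a3 b1 b2 b3 c1 c2 c3 = 0.
Proof.
pose M := \matrix_(i < 3, j < 3)
  nth 0 (nth [::] [:: [:: a1; b1; c1]; [:: a2; b2; c2]; [:: a3; b3; c3]] i) j.
have detM : \det M = det3 a1 a2 a3 b1 b2 b3 c1 c2 c3.
  rewrite (expand_det_row _ ord0) !big_ord_recl big_ord0 /cofactor.
  rewrite !(expand_det_row _ ord0) !big_ord_recl !big_ord0 /cofactor !det_mx11.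
  by rewrite !mxE /= /bump /= /det3; ring.
rewrite -detM; split=> [[x [y [z [nz ea eb ec]]]] | /eqP/det0P[v nzv vM]].
  apply/eqP/det0P; exists (\row_j nth 0 [:: x; y; z] j).
    apply: contraTN nz => /eqP/rowP v0; rewrite !negb_or !negbK.
    have := v0 (inord 2); have := v0 (inord 1); have := v0 ord0.
    by rewrite !mxE !inordK //= => -> -> ->; rewrite eqxx.
  apply/rowP=> j; rewrite !mxE !big_ord_recl big_ord0 !mxE /= addr0 addrA.
  by case: j => [[|[|[|]]]].
exists (v 0 ord0), (v 0 (lift ord0 ord0)), (v 0 (lift ord0 (lift ord0 ord0))).
have eM j : (v *m M) 0 j = 0 by rewrite vM mxE.
split.
- apply: contraNT nzv; rewrite !negb_or !negbK -andbA => /and3P[/eqP x0 /eqP y0 /eqP z0].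
  apply/eqP/rowP=> j; rewrite mxE.
  case: j => [[|[|[|]]]] //= h; [rewrite -x0 | rewrite -y0 | rewrite -z0];
    by congr (v _ _); apply: val_inj.
- by have := eM ord0; rewrite !mxE !big_ord_recl big_ord0 !mxE /= addr0 addrA.
- by have := eM (lift ord0 ord0); rewrite !mxE !big_ord_recl big_ord0 !mxE /= addr0 addrA.
- by have := eM (lift ord0 (lift ord0 ord0));
    rewrite !mxE !big_ord_recl big_ord0 !mxE /= addr0 addrA.
Qed.

(** * Linear forms and spans *)

Section Forms.
Variables (k : fieldType) (V : vectType k).
Implicit Types (U W : {vspace V}) (f : 'Hom(V, k^o)).

(** The values of a form live in [k^o], where scaling and multiplication are
    only convertible; these versions stay in the field [k]. *)
Lemma lformZ f (a : k) x : f (a *: x) = a * f x :> k.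
Proof. by rewrite linearZ. Qed.

Lemma lformD f x y : f (x + y) = f x + f y :> k.
Proof. by rewrite linearD. Qed.

Lemma lformB f x y : f (x - y) = f x - f y :> k.
Proof. by rewrite linearB. Qed.

(** A coordinate, in a complement of U, of the projection along U. *)
Lemma separating_form U v : v \notin U ->
  exists f, {in U, forall x, f x = 0} /\ f v = 1.
Proof.
move=> Uv; pose W := (U^C)%VS; pose w x := x - projv U x.
have wW : w v \in W := memv_projC _ _.
have nzw : w v != 0.
  by apply: contra Uv; rewrite subr_eq0 => /eqP->; apply: memv_proj.
have [i nzi] : exists i, coord (vbasis W) i (w v) != 0.
  apply/existsP; apply: contraR nzw; rewrite negb_exists => /forallP h.
  rewrite (coord_vbasis wW) big1 // => i _.
  by move: (h i); rewrite negbK => /eqP->; rewrite scale0r.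
pose f : 'Hom(V, k^o) := linfun (coord (vbasis W) i : V -> k^o).
exists ((f (w v))^-1 *: (f \o (\1 - projv U)))%VF.
have fE x : ((f (w v))^-1 *: (f \o (\1 - projv U)))%VF x = (f (w v))^-1 * f (w x).
  by rewrite scale_lfunE comp_lfunE add_lfunE opp_lfunE id_lfunE.
split=> [x xU|]; last by rewrite fE mulVf // lfunE.
by rewrite fE /w (projv_id xU) subrr linear0 mulr0.
Qed.

Lemma dim_lker_form f x : f x != 0 -> \dim (lker f) = (\dim {:V}).-1.
Proof.
move=> nzf; have := limg_ker_dim f fullv; rewrite capfv => <-.
suff -> : \dim (f @: fullv) = 1%N by rewrite addn1.
apply/eqP; rewrite eqn_leq; apply/andP; split.
  by apply: leq_trans (dimvS (subvf _)) _; rewrite dimvf.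
rewrite lt0n dimv_eq0; apply: contraNneq nzf => h.
by rewrite -memv0 -h memv_img ?memvf.
Qed.

Lemma memv_line2P (a b x : V) :
  reflect (exists s t, x = s *: a + t *: b) (x \in (<[a]> + <[b]>)%VS).
Proof.
apply: (iffP memv_addP) => [[_ /vlineP[s ->] [_ /vlineP[t ->] ->]]|[s [t ->]]].
  by exists s, t.
exists (s *: a); first exact/vlineP/(ex_intro _ s).
by exists (t *: b) => //; apply/vlineP/(ex_intro _ t).
Qed.

Lemma memv_line2_addP W (a b x : V) :
  reflect (exists s t, x - (s *: a + t *: b) \in W)
    (x \in (<[a]> + <[b]> + W)%VS).
Proof.
apply: (iffP memv_addP) => [[y /memv_line2P[s [t ->]] [w wW ->]]|[s [t h]]].
  by exists s, t; rewrite addrC addKr.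
exists (s *: a + t *: b); first by apply/memv_line2P; exists s, t.
by eexists; [exact: h | rewrite addrC subrK].
Qed.

End Forms.

(** * The Pascal condition in a frame *)

(** In this section [p1], [p2], [p3] complete [W] to the whole space and [c1],
    [c2], [c3] are the coordinates of the quotient by [W], which is a plane
    when its lines are seen as points. *)
Section Pascal.
Variables (k : fieldType) (V : vectType k) (W : {vspace V}).
Variables (p1 p2 p3 : V) (c1 c2 c3 : 'Hom(V, k^o)).
Hypotheses (c1P : [/\ c1 p1 = 1, c1 p2 = 0 & c1 p3 = 0])
           (c2P : [/\ c2 p1 = 0, c2 p2 = 1 & c2 p3 = 0])
           (c3P : [/\ c3 p1 = 0, c3 p2 = 0 & c3 p3 = 1]).
Hypothesis memW :
  forall x, reflect [/\ c1 x = 0, c2 x = 0 & c3 x = 0] (x \in W).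

Lemma form_mod_frame (f : 'Hom(V, k^o)) x : {in W, forall w, f w = 0} ->
  f x = f p1 * c1 x + f p2 * c2 x + f p3 * c3 x.
Proof.
case: c1P c2P c3P => [c11 c12 c13] [c21 c22 c23] [c31 c32 c33] fW.
pose r := x - (c1 x *: p1 + c2 x *: p2 + c3 x *: p3).
have /fW : r \in W.
  apply/memW; split; rewrite lformB !lformD !lformZ
    ?(c11, c12, c13) ?(c21, c22, c23) ?(c31, c32, c33); ring.
by rewrite lformB !lformD !lformZ => /eqP; rewrite subr_eq0 => /eqP->; ring.
Qed.

Variables u v w : V.
Hypotheses (nzu : [/\ c1 u != 0, c2 u != 0 & c3 u != 0])
           (nzv : [/\ c1 v != 0, c2 v != 0 & c3 v != 0])
           (nzw : [/\ c1 w != 0, c2 w != 0 & c3 w != 0]).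

(** The six points p1 p2 p3 u v w of the quotient plane form a hexagon whose
    opposite sides meet in (A1, A2, 0), (0, B2, B3) and (C1, C2, C3) below.
    A hyperplane containing W is a line of that plane, and the determinant of
    the three meeting points is that of the reciprocals times all nine
    coordinates. *)
Lemma pascal_iff_reciprocals_collinear :
  (exists H : {vspace V},
     [/\ \dim H = (\dim {:V}).-1,
         ((<[p1]> + <[p2]>) :&: (<[u]> + <[v]> + W) <= H)%VS,
         ((<[p2]> + <[p3]>) :&: (<[v]> + <[w]> + W) <= H)%VS,
         ((<[p3]> + <[u]>) :&: (<[p1]> + <[w]> + W) <= H)%VS
       & (W <= H)%VS])
  <-> det3 (c1 u)^-1 (c2 u)^-1 (c3 u)^-1 (c1 v)^-1 (c2 v)^-1 (c3 v)^-1
           (c1 w)^-1 (c2 w)^-1 (c3 w)^-1 = 0.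
Proof.
case: nzu nzv nzw => [u1 u2 u3] [v1 v2 v3] [w1 w2 w3].
case: (c1P) (c2P) (c3P) => [c11 c12 c13] [c21 c22 c23] [c31 c32 c33].
have cE := ((c11, c12, c13), (c21, c22, c23), (c31, c32, c33)).
pose A1 : k := c1 u * c3 v - c3 u * c1 v; pose A2 : k := c2 u * c3 v - c3 u * c2 v.
pose B2 : k := c2 v * c1 w - c1 v * c2 w; pose B3 : k := c3 v * c1 w - c1 v * c3 w.
pose C1 : k := c1 u * c2 w; pose C2 : k := c2 u * c2 w; pose C3 : k := c2 u * c3 w.
have detE : det3 A1 A2 0 0 B2 B3 C1 C2 C3 =
   c1 u * c2 u * c3 u * (c1 v * c2 v * c3 v) * (c1 w * c2 w * c3 w) *
   det3 (c1 u)^-1 (c2 u)^-1 (c3 u)^-1 (c1 v)^-1 (c2 v)^-1 (c3 v)^-1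
           (c1 w)^-1 (c2 w)^-1 (c3 w)^-1.
  by rewrite /det3 /A1 /A2 /B2 /B3 /C1 /C2 /C3; field; rewrite u1 u2 u3 v1 v2 v3 w1 w2 w3.
pose K : k := c1 u * c2 u * c3 u * (c1 v * c2 v * c3 v) * (c1 w * c2 w * c3 w).
have nzK : K != 0 by rewrite !mulf_neq0.
transitivity (det3 A1 A2 0 0 B2 B3 C1 C2 C3 = 0); last first.
  rewrite detE; split=> [/eqP|->]; last by rewrite mulr0.
  by rewrite mulf_eq0 (negPf nzK) => /eqP.
rewrite -det3_eq0; split.
- case=> H [dimH sA sB sC sW].
  have [z _ Hz] : exists2 z, z \in {:V}%VS & z \notin H.
    apply/subvPn; apply/negP=> /dimvS; rewrite dimH -ltnS prednK ?ltnn //.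
    rewrite lt0n dimv_eq0; apply/eqP=> V0.
    have : p1 \in {:V}%VS by rewrite memvf.
    rewrite V0 memv0 => /eqP p10; move: c11; rewrite p10 linear0.
    by move/eqP; rewrite eq_sym oner_eq0.
  have [f [fH fz]] := separating_form Hz.
  have fW x : x \in W -> f x = 0 by move=> xW; apply/fH/(subvP sW).
  have fE x := form_mod_frame x fW.
  exists (f p1), (f p2), (f p3); split.
  + rewrite -!negb_and; apply/negP=> /andP[/andP[/eqP f1 /eqP f2] /eqP f3].
    move: (fE z); rewrite fz f1 f2 f3 !mul0r !addr0 => /eqP.
    by rewrite oner_eq0.
  + have /fH : A1 *: p1 + A2 *: p2 \in H.
      apply/(subvP sA)/memv_capP; split; first by apply/memv_line2P; exists A1, A2.
      apply/memv_line2_addP; exists (c3 v), (- c3 u); apply/memW.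
      by split; rewrite lformB !lformD !lformZ !cE /A1 /A2; ring.
    by rewrite lformD !lformZ => fA; rewrite -[RHS]fA; ring.
  + have /fH : B2 *: p2 + B3 *: p3 \in H.
      apply/(subvP sB)/memv_capP; split; first by apply/memv_line2P; exists B2, B3.
      apply/memv_line2_addP; exists (c1 w), (- c1 v); apply/memW.
      by split; rewrite lformB !lformD !lformZ !cE /B2 /B3; ring.
    by rewrite lformD !lformZ => fA; rewrite -[RHS]fA; ring.
  (* C = y p3 + (c2 w) u, since u has a component along p3. *)
  + pose y : k := c2 u * c3 w - c2 w * c3 u.
    have /fH : y *: p3 + c2 w *: u \in H.
      apply/(subvP sC)/memv_capP; split.
        by apply/memv_line2P; exists y, (c2 w).
      apply/memv_line2_addP; exists (c2 w * c1 u - c2 u * c1 w), (c2 u); apply/memW.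
      by split; rewrite lformB !lformD !lformZ !cE /y; ring.
    by rewrite lformD !lformZ (fE u) => fA; rewrite -[RHS]fA /C1 /C2 /C3 /y; ring.
- case=> x [y [z [nz eA eB eC]]].
  pose f : 'Hom(V, k^o) := (x *: c1 + y *: c2 + z *: c3)%VF.
  have fE t : f t = x * c1 t + y * c2 t + z * c3 t :> k.
    by rewrite /f !add_lfunE !scale_lfunE.
  have fp : [/\ f p1 = x :> k, f p2 = y :> k & f p3 = z :> k].
    by rewrite !fE !cE; split; ring.
  case: fp => f1 f2 f3.
  exists (lker f); split.
  + case/orP: nz => [/orP[]|]; [rewrite -f1 | rewrite -f2 | rewrite -f3];
      exact: dim_lker_form.
  + apply/subvP=> _ /memv_capP[/memv_line2P[a [b ->]] /memv_line2_addP[s [t]]].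
    move/memW; rewrite !lformB !lformD !lformZ !cE => -[e1 e2 e3].
    have ea : a = s * c1 u + t * c1 v.
      by apply/eqP; rewrite -subr_eq0 -[X in _ == X]e1; apply/eqP; ring.
    have eb : b = s * c2 u + t * c2 v.
      by apply/eqP; rewrite -subr_eq0 -[X in _ == X]e2; apply/eqP; ring.
    have ez : s * c3 u + t * c3 v = 0 by rewrite -[RHS]oppr0 -e3; ring.
    (* As t is - s (c3 u) / (c3 v), the point is a multiple of A; multiplying
       by c3 v avoids the division. *)
    rewrite memv_ker fE !lformD !lformZ !cE -(mulrI_eq0 _ (mulfI v3)); apply/eqP.
    transitivity (s * (x * A1 + y * A2 + z * 0)
      + (x * c1 v + y * c2 v) * (s * c3 u + t * c3 v)).
      by rewrite ea eb /A1 /A2; ring.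
    by rewrite eA ez; ring.
  + apply/subvP=> _ /memv_capP[/memv_line2P[a [b ->]] /memv_line2_addP[s [t]]].
    move/memW; rewrite !lformB !lformD !lformZ !cE => -[e1 e2 e3].
    have ea : a = s * c2 v + t * c2 w.
      by apply/eqP; rewrite -subr_eq0 -[X in _ == X]e2; apply/eqP; ring.
    have eb : b = s * c3 v + t * c3 w.
      by apply/eqP; rewrite -subr_eq0 -[X in _ == X]e3; apply/eqP; ring.
    have ez : s * c1 v + t * c1 w = 0 by rewrite -[RHS]oppr0 -e1; ring.
    rewrite memv_ker fE !lformD !lformZ !cE -(mulrI_eq0 _ (mulfI w1)); apply/eqP.
    transitivity (s * (x * 0 + y * B2 + z * B3)
      + (y * c2 w + z * c3 w) * (s * c1 v + t * c1 w)).
      by rewrite ea eb /B2 /B3; ring.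
    by rewrite eB ez; ring.
  + apply/subvP=> _ /memv_capP[/memv_line2P[a [b ->]] /memv_line2_addP[s [t]]].
    move/memW; rewrite !lformB !lformD !lformZ !cE => -[_ e2 e3].
    have ea : a = t * c3 w - b * c3 u.
      by apply/eqP; rewrite -subr_eq0 -[X in _ == X]e3; apply/eqP; ring.
    have ez : b * c2 u - t * c2 w = 0 by rewrite -[RHS]e2; ring.
    rewrite memv_ker fE !lformD !lformZ !cE -(mulrI_eq0 _ (mulfI w2)); apply/eqP.
    transitivity (b * (x * C1 + y * C2 + z * C3)
      - z * c3 w * (b * c2 u - t * c2 w)).
      by rewrite ea /C1 /C2 /C3; ring.
    by rewrite eC ez; ring.
  + apply/subvP=> t /memW[t1 t2 t3].
    by rewrite memv_ker fE t1 t2 t3 !mulr0 !addr0.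
Qed.
End Pascal.

(** * Points in general position and their dual bases *)

Lemma pt_line_generator (k : fieldType) (d : nat) (Q : proj_point k d) :
  exists v, pt_line Q = <[v]>%VS.
Proof.
case: Q => U /= /eqP dimU; have nzU : U != 0%VS by rewrite -dimv_eq0 dimU.
exists (vpick U).
apply/esym/eqP; rewrite eqEdim -memvE memv_pick dimU dim_vline vpick0.
by rewrite nzU.
Qed.

Lemma dim_rV (k : fieldType) n : \dim {: 'rV[k]_n} = n.
Proof. by rewrite dimvf /dim /= mul1n. Qed.

Section GeneralPosition.
Variables (k : fieldType) (d : nat) (T : finType) (P : T -> proj_point k d).
Variable p : T -> 'rV[k]_d.+1.
Hypothesis pE : forall i, pt_line (P i) = <[p i]>%VS.
Implicit Types (J K : {set T}) (f : 'Hom('rV[k]_d.+1, k^o)).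

Lemma span_ptsU J K : span_pts P (J :|: K) = (span_pts P J + span_pts P K)%VS.
Proof.
apply/eqP; rewrite eqEsubv; apply/andP; split.
  apply/subv_sumP=> j /setUP[] jJ; rewrite -[pt_line _]addv0.
    by rewrite addvS ?sub0v // (sumv_sup j).
  by rewrite addvC addvS ?sub0v // (sumv_sup j).
by rewrite subv_add; apply/andP; split; apply/subv_sumP=> j jJ;
  rewrite (sumv_sup j) // inE jJ ?orbT.
Qed.

Lemma span_pts1 j : span_pts P [set j] = <[p j]>%VS.
Proof. by rewrite /span_pts big_set1 pE. Qed.

Lemma mem_span_pts J j : j \in J -> p j \in span_pts P J.
Proof.
by move=> jJ; rewrite memvE -pE (sumv_sup j).
Qed.

Lemma form_span_eq0 J f : (forall j, j \in J -> f (p j) = 0) ->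
  {in span_pts P J, forall x, f x = 0}.
Proof.
move=> fJ x xJ; apply/eqP; rewrite -memv_ker; apply: subvP xJ.
by apply/subv_sumP=> j /fJ fj; rewrite pE -memvE memv_ker fj.
Qed.

Hypothesis hP : general_linear_position P.

(** The form in which general position is used: d + 1 of the points determine
    a linear form. *)
Lemma form_eq0 J f : #|J| = d.+1 -> (forall j, j \in J -> f (p j) = 0) ->
  forall x, f x = 0.
Proof.
by move=> /hP spanJ fJ x; apply: (form_span_eq0 fJ); rewrite spanJ memvf.
Qed.

(** [f] is the coordinate along [p j] in the basis [p m], [m \in J]. *)
Definition dual_form J j f := f (p j) = 1 /\ {in J :\ j, forall m, f (p m) = 0}.

Lemma dual_form_exists J j : #|J| = d.+1 -> j \in J -> exists f, dual_form J j f.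
Proof.
move=> cardJ jJ; have spanJ := hP cardJ.
have pj : p j \notin span_pts P (J :\ j).
  apply/negP=> pj.
  have : (span_pts P J <= span_pts P (J :\ j))%VS.
    apply/subv_sumP=> m mJ; have [->|mj] := eqVneq m j; first by rewrite pE -memvE.
    by rewrite (sumv_sup m) // in_setD1 mj.
  rewrite spanJ => /dimvS; rewrite dim_rV leqNgt => /negP[].
  apply: leq_ltn_trans (dimv_leq_sum _ _ _) _.
  rewrite (eq_bigr (fun=> 1%N)); last by move=> m _; case: (P m) => U /= /eqP.
  by rewrite sum1_card -cardJ (cardsD1 j J) jJ.
have [f [fJ fj]] := separating_form pj.
by exists f; split=> // m mJ; apply/fJ/mem_span_pts.
Qed.

(** Otherwise f would vanish on the d + 1 points obtained from J by exchanging
    j for i. *)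
Lemma dual_form_neq0 J j i f : #|J| = d.+1 -> j \in J -> i \notin J ->
  dual_form J j f -> f (p i) != 0.
Proof.
move=> cardJ jJ iJ [fj fJ]; apply/eqP=> fi.
have card' : #|i |: J :\ j| = d.+1.
  rewrite cardsU1 !inE (negPf iJ) andbF /=.
  by move: cardJ; rewrite (cardsD1 j) jJ.
have f0 : f (p j) = 0.
  by apply: (form_eq0 card') => m /setU1P[->//|]; apply: fJ.
by move/eqP: fj; rewrite f0 eq_sym oner_eq0.
Qed.

Hypothesis cardT : #|T| = (d + 4)%N.

Lemma card_setC3 (i4 i5 i6 : T) : uniq [:: i4; i5; i6] -> #|~: [set i4; i5; i6]| = d.+1.
Proof.
move=> u; have := cardsC [set i4; i5; i6]; rewrite cardT.
have -> : #|[set i4; i5; i6]| = 3.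
  rewrite -[RHS]/(size [:: i4; i5; i6]) -(card_uniqP u).
  by apply: eq_card => i; rewrite !inE -orbA.
by rewrite addn4 => -[].
Qed.

(** The condition of the theorem for one hexagon, whose vertices need not come
    in increasing order. *)
Definition pascal_condition (I : {set T}) (i1 i2 i3 i4 i5 i6 : T) :=
  exists H : {vspace 'rV[k]_d.+1},
        [/\ hyperplane H,
            (span_pts P [set i1; i2]
               :&: span_pts P ([set i4; i5] :|: ~: I) <= H)%VS,
            (span_pts P [set i2; i3]
               :&: span_pts P ([set i5; i6] :|: ~: I) <= H)%VS,
            (span_pts P [set i3; i4]
               :&: span_pts P ([set i1; i6] :|: ~: I) <= H)%VS
          & forall j, j \in ~: I -> (P j <= H)%VS].

(** The frame is the dual basis of all points but i4, i5, i6, and [W] is the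
    span of the points outside the hexagon. *)
Lemma pascal_condition_iff_det3 (i1 i2 i3 i4 i5 i6 : T)
    (c1 c2 c3 : 'Hom('rV[k]_d.+1, k^o)) :
    let J := ~: [set i4; i5; i6] in
    uniq [:: i1; i2; i3; i4; i5; i6] ->
    dual_form J i1 c1 -> dual_form J i2 c2 -> dual_form J i3 c3 ->
  pascal_condition [set i1; i2; i3; i4; i5; i6] i1 i2 i3 i4 i5 i6 <->
  det3 (c1 (p i4))^-1 (c2 (p i4))^-1 (c3 (p i4))^-1
       (c1 (p i5))^-1 (c2 (p i5))^-1 (c3 (p i5))^-1
       (c1 (p i6))^-1 (c2 (p i6))^-1 (c3 (p i6))^-1 = 0.
Proof.
move=> J uI d1 d2 d3; set I := [set i1; i2; i3; i4; i5; i6].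
have u456 : uniq [:: i4; i5; i6] by case/and4P: uI.
have cardJ : #|J| = d.+1 by exact: card_setC3.
move: (uI); rewrite /= !inE !negb_or -!andbA.
case/and5P=> n12 n13 n14 n15 /and5P[n16 n23 n24 n25].
case/and5P=> n26 n34 n35 n36 /and4P[n45 n46 n56 _].
have JI : J = [set i1; i2; i3] :|: ~: I.
  apply/setP=> i; rewrite !inE.
  case: (eqVneq i i1) => [->|_]; first by rewrite !negb_or n14 n15 n16.
  case: (eqVneq i i2) => [->|_]; first by rewrite !negb_or n24 n25 n26.
  by case: (eqVneq i i3) => [->|_]; first by rewrite !negb_or n34 n35 n36.
have inJ i : i \in [:: i1; i2; i3] -> i \in J.
  by rewrite JI !inE; case/or3P=> ->; rewrite ?orbT.
have [m1 m2 m3] : [/\ i1 \in J, i2 \in J & i3 \in J].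
  by split; apply: inJ; rewrite !inE eqxx ?orbT.
have KJ j : j \in ~: I -> j \in J by move=> jI; rewrite JI in_setU jI orbT.
have KD j : j \in ~: I -> [/\ j \in J :\ i1, j \in J :\ i2 & j \in J :\ i3].
  move=> jI; rewrite ![j \in J :\ _]in_setD1 (KJ j jI) !andbT.
  by move: jI; rewrite !inE !negb_or -!andbA => /and4P[].
have [c11 z1] := d1; have [c22 z2] := d2; have [c33 z3] := d3.
have nz j c i : j \in J -> dual_form J j c -> i \in [:: i4; i5; i6] -> c (p i) != 0.
  move=> jJ dj iI; apply: (dual_form_neq0 cardJ jJ _ dj).
  by move: iI; rewrite !inE negbK orbA.
have c1P : [/\ c1 (p i1) = 1, c1 (p i2) = 0 & c1 (p i3) = 0].
  by split=> //; apply: z1; rewrite in_setD1 ?m2 ?m3 andbT eq_sym.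
have c2P : [/\ c2 (p i1) = 0, c2 (p i2) = 1 & c2 (p i3) = 0].
  by split=> //; apply: z2; rewrite in_setD1 ?m1 ?m3 andbT // eq_sym.
have c3P : [/\ c3 (p i1) = 0, c3 (p i2) = 0 & c3 (p i3) = 1].
  by split=> //; apply: z3; rewrite in_setD1 ?m1 ?m2 andbT // eq_sym.
have memW x : reflect [/\ c1 x = 0, c2 x = 0 & c3 x = 0] (x \in span_pts P (~: I)).
  apply: (iffP idP) => [xW|[x1 x2 x3]].
    by split; apply: (@form_span_eq0 (~: I)) xW => j /KD[];
      [move/z1|move=> _ /z2|move=> _ _ /z3].
  have : x \in span_pts P J by rewrite (hP cardJ) memvf.
  rewrite JI !span_ptsU !span_pts1 => /memv_addP[y /memv_addP[y' /memv_line2P[a [b ->]]]].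
  move=> [_ /vlineP[c ->] ->] [w wK xE].
  have cw f : f \in [:: c1; c2; c3] -> f w = 0.
    move=> fc; apply: (@form_span_eq0 (~: I)) wK => j /KD[j1 j2 j3].
    by move: fc; rewrite !inE => /or3P[] /eqP->; [apply: z1|apply: z2|apply: z3].
  move: x1 x2 x3; rewrite xE !lformD !lformZ !cw ?inE ?eqxx ?orbT //.
  case: c1P c2P c3P => [-> -> ->] [-> -> ->] [-> -> ->].
  rewrite !(mulr0, mulr1, addr0, add0r) => -> -> ->.
  by rewrite !scale0r !add0r.
rewrite -(pascal_iff_reciprocals_collinear c1P c2P c3P memW); first last.
- by split; [apply: (nz i1)|apply: (nz i2)|apply: (nz i3)] => //; rewrite !inE eqxx ?orbT.
- by split; [apply: (nz i1)|apply: (nz i2)|apply: (nz i3)] => //; rewrite !inE eqxx ?orbT.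
- by split; [apply: (nz i1)|apply: (nz i2)|apply: (nz i3)] => //; rewrite !inE eqxx ?orbT.
rewrite /pascal_condition /hyperplane dim_rV /= !span_ptsU !span_pts1.
split=> -[H [h1 h2 h3 h4 h5]]; exists H; split=> //; first exact/subv_sumP.
by move=> j jI; move/subv_sumP: h5; apply.
Qed.

End GeneralPosition.

(** * Rational normal curves and binary forms *)

(** As a function of x, [bracket x y] is the binary linear form with root y. *)
Definition bracket (R : pzRingType) (x y : R * R) : R := x.1 * y.2 - x.2 * y.1.

(** Three vectors of a 2-dimensional space are linearly dependent. *)
Lemma det3_bracket (k : comPzRingType) (x1 x2 x3 y1 y2 y3 : k * k) :
  det3 (bracket x1 y1) (bracket x1 y2) (bracket x1 y3)
       (bracket x2 y1) (bracket x2 y2) (bracket x2 y3)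
       (bracket x3 y1) (bracket x3 y2) (bracket x3 y3) = 0.
Proof. by rewrite /det3 /bracket; ring. Qed.

Lemma det3_scale (k : comPzRingType) (r1 r2 r3 s1 s2 s3 a1 a2 a3 b1 b2 b3 c1 c2 c3 : k) :
  det3 (s1 * a1 * r1) (s2 * a2 * r1) (s3 * a3 * r1)
       (s1 * b1 * r2) (s2 * b2 * r2) (s3 * b3 * r2)
       (s1 * c1 * r3) (s2 * c2 * r3) (s3 * c3 * r3) =
  r1 * r2 * r3 * (s1 * s2 * s3) * det3 a1 a2 a3 b1 b2 b3 c1 c2 c3.
Proof. by rewrite /det3; ring. Qed.

Section ColumnForm.
Variables (k : fieldType) (n : nat) (c : 'cV[k]_n).

Definition column_form (v : 'rV[k]_n) : k^o := (v *m c) 0 0.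

Fact column_form_linear : linear column_form.
Proof. by move=> a x y; rewrite /column_form mulmxDl -scalemxAl !mxE. Qed.

HB.instance Definition _ :=
  GRing.isLinear.Build k 'rV[k]_n k^o *:%R column_form column_form_linear.
End ColumnForm.

Lemma column_formE (k : fieldType) n (c : 'cV[k]_n) v :
  linfun (column_form c) v = (v *m c) 0 0.
Proof. by rewrite lfunE. Qed.

Section Veronese.
Variable k : fieldType.

(** The coefficients of a product of linear binary forms, by induction on the
    number of factors. *)
Lemma binary_form_coefs (l : seq (k * k)) : exists c : nat -> k, forall x,
  \sum_(i < (size l).+1) x.1 ^+ (size l - i) * x.2 ^+ i * c i =
  \prod_(y <- l) bracket x y.
Proof.
elim: l => [|y l [c cE]].
  by exists (fun=> 1) => x; rewrite big_nil big_ord1 !expr0 !mulr1.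
pose n := size l.
(* [a] and [b] hold the coefficients of the products by x.1 and by x.2; the
   bound in [a] cuts off the values of [c] beyond the degree. *)
pose a i := if (i <= n)%N then c i else 0.
pose b i := if i is j.+1 then c j else 0.
exists (fun i => y.2 * a i - y.1 * b i) => x; rewrite big_cons -cE -/n.
under eq_bigr do rewrite mulrBr.
rewrite sumrB big_ord_recr [X in _ - X]big_ord_recl /=.
rewrite /a ltnn !mulr0 addr0 add0r -/n /bracket mulrBl !mulr_sumr.
congr (_ - _); apply: eq_bigr => i _.
  have le_in : (i <= n)%N by rewrite -ltnS.
  by rewrite le_in subSn // exprS; move: (_ ^+ (n - i)) (_ ^+ i) => X Y; ring.
rewrite /bump /= add1n subSS exprS; move: (_ ^+ (n - i)) (_ ^+ i) => X Y; ring.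
Qed.

(** Hyperplane sections of the Veronese curve are binary forms of degree d; this
    is the hyperplane meeting it in the d parameters listed in [l]. *)
Lemma veronese_product_column d (l : seq (k * k)) : size l = d ->
  exists c : 'cV[k]_d.+1, forall x,
    (veronese d x.1 x.2 *m c) 0 0 = \prod_(y <- l) bracket x y.
Proof.
move=> <-; have [c cE] := binary_form_coefs l.
exists (\col_i c i) => x; rewrite -cE mxE.
by apply: eq_bigr => i _; rewrite !mxE.
Qed.

Lemma veroneseZ d (a s t : k) :
  veronese d (a * s) (a * t) = a ^+ d *: veronese d s t.
Proof.
apply/rowP=> i; rewrite !mxE !exprMn mulrACA -exprD subnK //.
by rewrite -ltnS.
Qed.

Lemma bracket_eq0_proportional (x y : k * k) :
  x != 0 -> bracket x y = 0 -> exists a, y = (a * x.1, a * x.2).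
Proof.
case: x y => [x1 x2] [y1 y2]; rewrite /bracket /= => nzx /subr0_eq xy.
have [x10|x10] := eqVneq x1 0; last first.
  by exists (y1 / x1); rewrite divfK // mulrAC -[y1 * x2]mulrC -xy mulrAC divff // mul1r.
have x20 : x2 != 0 by apply: contraNneq nzx => ->; rewrite x10.
by exists (y2 / x2); rewrite divfK // mulrAC -[y2 * x1]mulrC xy mulrAC divff // mul1r.
Qed.

End Veronese.

Section Curve.
Variables (k : fieldType) (d : nat) (T : finType) (P : T -> proj_point k d).
Variable p : T -> 'rV[k]_d.+1.
Hypothesis pE : forall i, pt_line (P i) = <[p i]>%VS.
Hypothesis hP : general_linear_position P.
Hypothesis cardT : #|T| = (d + 4)%N.
Implicit Types (J K : {set T}) (f : 'Hom('rV[k]_d.+1, k^o)).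

(** * The Pascal condition on a rational normal curve *)

Section OnCurve.
Variables (g : 'M[k]_d.+1) (x : T -> k * k).
Hypotheses (gU : g \in unitmx) (nzx : forall i, x i != 0).
Hypothesis px : forall i, p i = veronese d (x i).1 (x i).2 *m g.
Hypothesis d_gt0 : (0 < d)%N.

(** Proportional parameters give proportional points, which cannot both belong
    to a basis. *)
Lemma bracket_parameters_neq0 i j : i != j -> bracket (x i) (x j) != 0.
Proof.
move=> ij; apply/eqP=> /(bracket_eq0_proportional (nzx i))[a xj].
have : (2 < #|~: [set i; j]|)%N.
  have := cardsC [set i; j]; rewrite cards2 ij cardT addn4 /= => /eqP.
  by rewrite 2!addSn add0n !eqSS => /eqP->.
case/card_gt2P=> [a4 [a5 [a6 [[m4 m5 m6] [n45 n56 n64]]]]].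
have u : uniq [:: a4; a5; a6] by rewrite /= !inE negb_or n45 n56 eq_sym n64.
have inJ m : m \in [set i; j] -> m \in ~: [set a4; a5; a6].
  move=> mij; rewrite !inE -orbA; apply/negP=> /or3P[] /eqP me;
    [move: m4|move: m5|move: m6]; by rewrite inE -me mij.
have [f [fj fJ]] := dual_form_exists pE hP (card_setC3 cardT u) (inJ j (set22 _ _)).
have fi : f (p i) = 0 by apply: fJ; rewrite in_setD1 ij inJ ?set21.
by move/eqP: fj; rewrite px xj veroneseZ -scalemxAl -px lformZ fi mulr0 eq_sym oner_eq0.
Qed.

(** Up to a scalar, the dual form at j is, on the curve, the product of the
    brackets with the parameters of the other points of J.  This is the product
    over all of J, common to all j, divided by the bracket with the parameter of
    j; so the reciprocal is linear in that bracket. *)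
Lemma dual_form_on_curve J j : #|J| = d.+1 -> j \in J ->
  exists f s, dual_form p J j f /\ forall i, i \notin J ->
    (f (p i))^-1 = s * bracket (x i) (x j) / \prod_(m in J) bracket (x i) (x m).
Proof.
move=> cardJ jJ; pose l := [seq x m | m <- enum (J :\ j)].
have sz : size l = d.
  by rewrite size_map -cardE; move: cardJ; rewrite (cardsD1 j) jJ => -[].
have [c cE] := veronese_product_column sz.
pose h : 'Hom('rV[k]_d.+1, k^o) := linfun (column_form (invmx g *m c)).
have hE i : h (p i) = \prod_(m in J :\ j) bracket (x i) (x m).
  by rewrite /h column_formE px mulmxA mulmxK // cE big_map big_enum.
have nzN : h (p j) != 0.
  rewrite hE; apply/prodf_neq0 => m; rewrite in_setD1 => /andP[mj _].
  by rewrite bracket_parameters_neq0 // eq_sym.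
exists ((h (p j))^-1 *: h)%VF, (h (p j)); split.
  split=> [|m mJ]; rewrite scale_lfunE /GRing.scale /= ?mulVf //.
  by rewrite [h (p m)]hE (big_setD1 m) //= /bracket [_.2 * _]mulrC subrr mul0r mulr0.
move=> i iJ; rewrite scale_lfunE /GRing.scale /= invfM invrK -mulrA; congr (_ * _).
rewrite [in RHS](big_setD1 j) //= -hE invfM mulrA divff ?mul1r //.
by rewrite bracket_parameters_neq0 //; apply: contraNneq iJ => ->.
Qed.

(** The factors depending only on the row or only on the column come out of the
    minor of reciprocals, and a minor of brackets remains. *)
Lemma pascal_condition_on_curve i1 i2 i3 i4 i5 i6 :
  uniq [:: i1; i2; i3; i4; i5; i6] ->
  pascal_condition P [set i1; i2; i3; i4; i5; i6] i1 i2 i3 i4 i5 i6.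
Proof.
move=> u; pose J := ~: [set i4; i5; i6].
have u456 : uniq [:: i4; i5; i6] by case/and4P: u.
have cardJ : #|J| = d.+1 by exact: card_setC3.
have inJ m : m \in [:: i1; i2; i3] -> m \in J.
  move: u; rewrite -[[:: i1, i2 & _]]/([:: i1; i2; i3] ++ [:: i4; i5; i6]) cat_uniq.
  case/and3P=> _ /hasPn h _ m123; rewrite !inE -orbA; apply/negP=> m456.
  by have := h m; rewrite !inE m456 /= => /(_ isT)/negP[]; move: m123; rewrite !inE.
have [f1 [s1 [d1 e1]]] := dual_form_on_curve cardJ (inJ i1 (mem_head _ _)).
have [|f2 [s2 [d2 e2]]] := @dual_form_on_curve J i2 cardJ.
  by apply: inJ; rewrite !inE eqxx orbT.
have [|f3 [s3 [d3 e3]]] := @dual_form_on_curve J i3 cardJ.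
  by apply: inJ; rewrite !inE eqxx !orbT.
apply/(pascal_condition_iff_det3 pE hP cardT u d1 d2 d3).
have nJ m : m \in [:: i4; i5; i6] -> m \notin J by rewrite !inE negbK orbA.
have [m4 m5 m6] : [/\ i4 \notin J, i5 \notin J & i6 \notin J].
  by split; apply: nJ; rewrite !inE eqxx ?orbT.
rewrite !(e1, e2, e3) //.
by rewrite det3_scale det3_bracket mulr0.
Qed.

End OnCurve.

(** * A rational normal curve from the Pascal conditions *)

Lemma dual_forms_decomposition J (c : T -> 'Hom('rV[k]_d.+1, k^o)) y :
  #|J| = d.+1 -> (forall j, j \in J -> dual_form p J j (c j)) ->
  y = \sum_(j in J) c j y *: p j.
Proof.
move=> cardJ cP; have : y \in span_pts P J by rewrite (hP cardJ) memvf.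
case/memv_sumP=> v vP ->; apply: eq_bigr => j jJ.
have vE m : m \in J -> exists a, v m = a *: p m.
  by move=> /vP; rewrite pE => /vlineP.
rewrite linear_sum (bigD1 j) //= big1 ?addr0 => [|m /andP[mJ mj]]; last first.
  have [a ->] := vE m mJ; have [_ cj] := cP j jJ.
  by rewrite lformZ cj ?mulr0 // in_setD1 mj.
have [a ->] := vE j jJ; have [cj _] := cP j jJ.
by rewrite lformZ cj mulr1.
Qed.

(** Exchanging m for i turns J into another basis J'; eliminating the coordinate
    f' from f gives the dual form of J' at j, so it cannot vanish at i'. *)
Lemma dual_form_minor_neq0 J j m i i' f f' : #|J| = d.+1 ->
  j \in J -> m \in J -> j != m -> i \notin J -> i' \notin J -> i != i' ->
  dual_form p J j f -> dual_form p J m f' ->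
  f (p i) * f' (p i') - f' (p i) * f (p i') != 0.
Proof.
move=> cardJ jJ mJ jm iJ iJ' ii' fP fP'.
have nz := dual_form_neq0 pE hP cardJ mJ iJ fP'.
have [fj fJ] := fP; have [fm' fJ'] := fP'.
pose J' := i |: J :\ m.
have cardJ' : #|J'| = d.+1.
  rewrite cardsU1 !inE (negPf iJ) andbF /=.
  by move: cardJ; rewrite (cardsD1 m) mJ.
pose h : 'Hom('rV[k]_d.+1, k^o) := (f - (f (p i) / f' (p i)) *: f')%VF.
have hE y : h y = f y - f (p i) / f' (p i) * f' y.
  by rewrite add_lfunE opp_lfunE scale_lfunE.
have hP' : dual_form p J' j h.
  split=> [|n]; rewrite hE.
    have f'j : f' (p j) = 0 by apply: fJ'; rewrite in_setD1 jm.
    by rewrite fj f'j mulr0 subr0.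
  rewrite !inE => /andP[nj] /orP[/eqP->|/andP[nm nJ]]; first by rewrite divfK // subrr.
  have fn : f (p n) = 0 by apply: fJ; rewrite in_setD1 nj.
  have f'n : f' (p n) = 0 by apply: fJ'; rewrite in_setD1 nm.
  by rewrite fn f'n mulr0 subrr.
have jJ' : j \in J' by rewrite !inE jm jJ orbT.
have iJ'' : i' \notin J' by rewrite !inE negb_or eq_sym ii' (negPf iJ') andbF.
have := dual_form_neq0 pE hP cardJ' jJ' iJ'' hP'.
apply: contra => /eqP h0; rewrite hE -(mulrI_eq0 _ (mulfI nz)).
apply/eqP; rewrite -[RHS]oppr0 -h0 mulrBr mulrA [f' _ * (_ / _)]mulrC divfK //.
by ring.
Qed.

(** The curve is z |-> sum over j of (prod over m <> j of [z, y_m]) p_j.  At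
    z = y_j only the j-th term survives; at z = x_i the j-th product is the full
    product divided by [x_i, y_j], that is, times the coordinate of p_i along
    p_j, so the sum is a multiple of p_i. *)
Lemma curve_through_points J (c : T -> 'Hom('rV[k]_d.+1, k^o))
    (x y : T -> k * k) :
  (0 < d)%N -> #|J| = d.+1 -> (forall j, j \in J -> dual_form p J j (c j)) ->
  {in J &, forall j m, j != m -> bracket (y j) (y m) != 0} ->
  (forall i j, i \notin J -> j \in J -> bracket (x i) (y j) = (c j (p i))^-1) ->
  exists C : proj_point k d -> Prop,
    rational_normal_curve C /\ forall i, C (P i).
Proof.
move=> d_gt0 cardJ cP nzy xE.
have szl j : j \in J -> size [seq y m | m <- enum (J :\ j)] = d.
  move=> jJ; rewrite size_map -cardE.
  by move: cardJ; rewrite (cardsD1 j) jJ => -[].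
have [e eE] : exists e : T -> 'cV[k]_d.+1, forall j, j \in J -> forall z,
    (veronese d z.1 z.2 *m e j) 0 0 = \prod_(m in J :\ j) bracket z (y m).
  apply: (@fin_all_exists _ _ (fun j ej => j \in J -> forall z,
    (veronese d z.1 z.2 *m ej) 0 0 = \prod_(m in J :\ j) bracket z (y m))) => j.
  have [jJ|_] := boolP (j \in J); last by exists 0.
  have [ej ejE] := veronese_product_column (szl j jJ).
  by exists ej => _ z; rewrite ejE big_map big_enum.
pose g := \sum_(j in J) e j *m p j.
have gE z : veronese d z.1 z.2 *m g =
    \sum_(j in J) (\prod_(m in J :\ j) bracket z (y m)) *: p j.
  rewrite mulmx_sumr; apply: eq_bigr => j jJ.
  by rewrite mulmxA [_ *m e j]mx11_scalar mul_scalar_mx eE.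
pose z i := if i \in J then y i else x i.
have zP i : z i != 0 /\
    exists2 a, a != 0 & veronese d (z i).1 (z i).2 *m g = a *: p i.
  rewrite gE /z; have [iJ|iJ] := boolP (i \in J).
    split.
      have : (0 < #|J :\ i|)%N by move: cardJ; rewrite (cardsD1 i) iJ add1n => -[->].
      case/card_gt0P=> m; rewrite in_setD1 => /andP[mi mJ].
      have := nzy m i mJ iJ mi; apply: contraNneq => ->.
      by rewrite /bracket /= !mulr0 subrr.
    exists (\prod_(m in J :\ i) bracket (y i) (y m)).
      apply/prodf_neq0 => m; rewrite in_setD1 => /andP[mi mJ].
      by apply: nzy; rewrite // eq_sym.
    rewrite (bigD1 i) //= [X in _ + X]big1 ?addr0 // => j /andP[jJ ji].
    rewrite (big_setD1 i) /=; last by rewrite in_setD1 eq_sym ji.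
    by rewrite /bracket [_.2 * _]mulrC subrr mul0r scale0r.
  have nzx j : j \in J -> bracket (x i) (y j) != 0.
    move=> jJ; rewrite xE // invr_neq0 //.
    exact: (dual_form_neq0 pE hP cardJ jJ iJ (cP j jJ)).
  split.
    have : (0 < #|J|)%N by rewrite cardJ.
    case/card_gt0P=> m /nzx; apply: contraNneq => ->.
    by rewrite /bracket /= !mul0r subrr.
  exists (\prod_(j in J) bracket (x i) (y j)); first exact/prodf_neq0.
  rewrite [p i in RHS](dual_forms_decomposition _ cardJ cP) scaler_sumr.
  apply: eq_bigr => j jJ; rewrite scalerA; congr (_ *: _).
  rewrite [in RHS](big_setD1 j) //= xE // mulrAC mulVf ?mul1r //.
  by rewrite -invr_eq0 -xE // nzx.
(* A form killed by g vanishes on the curve, hence at the d + 1 points of J. *)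
have gU : g \in unitmx.
  rewrite -unitmx_tr -row_free_unit; apply: inj_row_free => v vg.
  have gv : g *m v^T = 0 by rewrite -[g]trmxK -trmx_mul vg trmx0.
  have fv0 := @form_eq0 _ _ _ _ _ pE hP J (linfun (column_form v^T)) cardJ.
  apply/rowP=> i; rewrite [RHS]mxE.
  have := fv0 _ (delta_mx 0 i); rewrite column_formE -rowE !mxE; apply=> j jJ.
  have [_ [a nza aE]] := zP j.
  apply: (mulfI nza); rewrite mulr0 -lformZ -aE column_formE -mulmxA gv mulmx0.
  by rewrite mxE.
exists (fun q => exists s t : k,
  (s, t) != (0, 0) /\ pt_line q = <[veronese d s t *m g]>%VS).
split=> [|i]; first by exists g.
have [nzz [a nza aE]] := zP i.
exists (z i).1, (z i).2; split; first by rewrite -surjective_pairing.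
rewrite aE pE; apply/eqP; rewrite eqEsubv -!memvE; apply/andP; split.
  by apply/vlineP; exists a^-1; rewrite scalerA mulVf // scale1r.
by apply/vlineP; exists a.
Qed.

(** Only the hexagons with vertices j0, j1, i4, i5, i6 are used: the columns j0
    and j1 of reciprocals are independent, so the relation between the three
    rows, found there by the Cramer rule, extends to column j as soon as the
    minor on j0, j1, j vanishes. *)
Lemma curve_of_pascal_conditions i4 i5 i6 j0 j1 :
  (0 < d)%N -> uniq [:: i4; i5; i6] ->
  let J := ~: [set i4; i5; i6] in
  j0 \in J -> j1 \in J -> j0 != j1 ->
  (forall j, j \in J -> j != j0 -> j != j1 ->
    pascal_condition P [set j0; j1; j; i4; i5; i6] j0 j1 j i4 i5 i6) ->
  exists C : proj_point k d -> Prop,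
    rational_normal_curve C /\ forall i, C (P i).
Proof.
move=> d_gt0 u456 J j0J j1J j01 pascal.
have cardJ : #|J| = d.+1 by exact: card_setC3.
have [c cP] : exists c : T -> 'Hom('rV[k]_d.+1, k^o),
    forall j, j \in J -> dual_form p J j (c j).
  apply: (@fin_all_exists _ _ (fun j cj => j \in J -> dual_form p J j cj)) => j.
  have [jJ|_] := boolP (j \in J); last by exists 0.
  by have [f fP] := dual_form_exists pE hP cardJ jJ; exists f.
have nJ m : m \in [:: i4; i5; i6] -> m \notin J by rewrite !inE negbK orbA.
have [i4J i5J i6J] : [/\ i4 \notin J, i5 \notin J & i6 \notin J].
  by split; apply: nJ; rewrite !inE eqxx ?orbT.
move: (u456); rewrite /= !inE negb_or andbT => /andP[/andP[n45 n46] n56].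
have nz i j : i \notin J -> j \in J -> c j (p i) != 0.
  by move=> iJ jJ; apply: (dual_form_neq0 pE hP cardJ jJ iJ (cP j jJ)).
pose r i j : k := (c j (p i))^-1.
have minor j m : j \in J -> m \in J -> j != m ->
    r i4 j * r i5 m - r i4 m * r i5 j != 0.
  move=> jJ mJ jm.
  have := dual_form_minor_neq0 cardJ jJ mJ jm i4J i5J n45 (cP j jJ) (cP m mJ).
  apply: contra => /eqP; rewrite /r => h.
  have [z1 z2 z3 z4] :=
    And4 (nz _ _ i4J jJ) (nz _ _ i4J mJ) (nz _ _ i5J jJ) (nz _ _ i5J mJ).
  rewrite -oppr_eq0; apply/eqP.
  transitivity (c j (p i4) * c m (p i4) * c j (p i5) * c m (p i5) * 0);
    last by rewrite mulr0.
  by rewrite -h; field; rewrite z1 z2 z3 z4.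
have delta := minor _ _ j0J j1J j01.
pose D := r i4 j0 * r i5 j1 - r i4 j1 * r i5 j0.
(* The Cramer solution of l r_i4 + m r_i5 = r_i6 in the columns j0 and j1. *)
pose l := (r i6 j0 * r i5 j1 - r i6 j1 * r i5 j0) / D.
pose m := (r i4 j0 * r i6 j1 - r i4 j1 * r i6 j0) / D.
have line j : j \in J -> l * r i4 j + m * r i5 j = r i6 j.
  move=> jJ.
  suff det0 : det3 (r i4 j0) (r i4 j1) (r i4 j) (r i5 j0) (r i5 j1) (r i5 j)
                   (r i6 j0) (r i6 j1) (r i6 j) = 0.
    apply/eqP; rewrite -subr_eq0 -(mulrI_eq0 _ (mulfI delta)); apply/eqP.
    by rewrite -[RHS]oppr0 -det0 /det3 /l /m /D; field.
  have [->|jj0] := eqVneq j j0; first by rewrite /det3; ring.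
  have [->|jj1] := eqVneq j j1; first by rewrite /det3; ring.
  have u : uniq [:: j0; j1; j; i4; i5; i6].
    rewrite -[[:: j0, j1 & _]]/([:: j0; j1; j] ++ [:: i4; i5; i6]) cat_uniq u456.
    rewrite andbT; apply/andP; split.
      by rewrite /= !inE negb_or j01 eq_sym jj0 eq_sym jj1.
    apply/hasPn=> i /nJ iJ; apply: contra iJ; move: i; apply/allP.
    by rewrite /= j0J j1J jJ.
  by apply/(pascal_condition_iff_det3 pE hP cardT u (cP _ j0J) (cP _ j1J) (cP _ jJ))/pascal.
(* The node y j is chosen so that [(s, t), y j] = s r_i4j + t r_i5j. *)
pose x i : k * k := if i == i4 then (1, 0) else if i == i5 then (0, 1) else (l, m).
pose y j : k * k := (- r i5 j, r i4 j).
apply: (@curve_through_points J c x y) => // [j n jJ nJ' jn|i j iJ jJ].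
  have := minor j n jJ nJ' jn; rewrite /bracket /=; apply: contra => /eqP h.
  by rewrite -h; apply/eqP; ring.
rewrite -[RHS]/(r i j).
have : i \in [:: i4; i5; i6] by move: iJ; rewrite !inE negbK orbA.
rewrite /x /bracket !inE; case: eqVneq => [->|_] /=; first by move=> _; ring.
case: eqVneq => [->|_] /=; first by move=> _; ring.
by move=> /eqP ->; rewrite -line //; ring.
Qed.

End Curve.

Theorem theorem1 (k : closedFieldType) (d : nat) (hd : (3 <= d)%N)
    (P : 'I_(d + 4) -> proj_point k d)
    (hP : general_linear_position P) :
  (exists C : proj_point k d -> Prop,
      rational_normal_curve C /\ forall i, C (P i))
  <->
  (forall (I : {set 'I_(d + 4)}) (i1 i2 i3 i4 i5 i6 : 'I_(d + 4)),
      I = [set i1; i2; i3; i4; i5; i6] ->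
      [&& i1 < i2, i2 < i3, i3 < i4, i4 < i5 & i5 < i6]%N ->
      exists H : {vspace 'rV[k]_d.+1},
        [/\ hyperplane H,
            (span_pts P [set i1; i2]
               :&: span_pts P ([set i4; i5] :|: ~: I) <= H)%VS,
            (span_pts P [set i2; i3]
               :&: span_pts P ([set i5; i6] :|: ~: I) <= H)%VS,
            (span_pts P [set i3; i4]
               :&: span_pts P ([set i1; i6] :|: ~: I) <= H)%VS
          & forall j, j \in ~: I -> (P j <= H)%VS]).
Proof.
have d_gt0 : (0 < d)%N by apply: leq_trans hd.
have cardT : #|'I_(d + 4)| = (d + 4)%N by rewrite card_ord.
split=> [[C [[g gU CE] CP]] I i1 i2 i3 i4 i5 i6 -> lt_i|pascal].
  have ex_x i : exists x : k * k,
      x != 0 /\ pt_line (P i) = <[veronese d x.1 x.2 *m g]>%VS.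
    by have [s [t st]] := (CE (P i)).1 (CP i); exists (s, t).
  have [x xP] := fin_all_exists ex_x.
  have u : uniq [:: i1; i2; i3; i4; i5; i6].
    apply: (@map_uniq _ _ val); apply: (sorted_uniq ltn_trans ltnn).
    by rewrite /= andbT.
  exact: (pascal_condition_on_curve (fun i => (xP i).2) hP cardT gU
    (fun i => (xP i).1) (fun=> erefl) d_gt0 u).
have [p pP] := fin_all_exists (fun i => pt_line_generator (P i)).
have lt_ord n : (n < 4)%N -> (d + n < d + 4)%N by rewrite ltn_add2l.
pose i4 := Ordinal (lt_ord 1 isT); pose i5 := Ordinal (lt_ord 2 isT).
pose i6 := Ordinal (lt_ord 3 isT).
have lt0 : (0 < d + 4)%N by rewrite addn4.
have lt1 : (1 < d + 4)%N by rewrite addn4.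
pose j0 := Ordinal lt0; pose j1 := Ordinal lt1.
have JE j : (j \in ~: [set i4; i5; i6]) = (j <= d)%N.
  by rewrite !inE -!val_eqE /= !negb_or; have := ltn_ord j; lia.
have u456 : uniq [:: i4; i5; i6].
  by rewrite /= !inE -!val_eqE /= !eqn_add2l.
have j0J : j0 \in ~: [set i4; i5; i6] by rewrite JE.
have j1J : j1 \in ~: [set i4; i5; i6] by rewrite JE.
apply: (curve_of_pascal_conditions pP hP cardT d_gt0 u456 j0J j1J isT).
move=> j; rewrite JE -!val_eqE /= => jd jn0 jn1; apply: pascal => //=.
by rewrite addn1 ltnS jd addn2 addn3 !ltnSn !andbT ltn_neqAle eq_sym jn1 lt0n jn0.
Qed.
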